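(* Let $C\subset\mathbf{E}^3$ be the Euclidean catenoid with axis $(0,0,1)$ and, for $t\in[0,\pi/2]$, let $C_t=G_t(C)$, where $G_t$ is the rotation of angle $t$ about the axis $(0,1,0)$ (so that $t$ is the angle that the rotation axis of the catenoid $C_t$ makes with the $z$-axis). Then the dual surfaces $C_t^\flat$, $t\in[0,\pi/2]$, belong to the family of Bonnet maximal surfaces in $\mathbf{L}^3$, starting from the elliptic catenoid for $t=0$ until the hyperbolic catenoid for $t=\pi/2$.
   Context: $\mathbf{E}^3$ and $\mathbf{L}^3$ denote $\mathbb{R}^3$ with the metric $dx^2+dy^2+\epsilon\,dz^2$, with $\epsilon=1$ and $\epsilon=-1$ respectively. A (conformal) minimal surface of $\mathbf{E}^3$ ($\epsilon=1$) or maximal surface of $\mathbf{L}^3$ ($\epsilon=-1$) is given on a simply-connected domain $\Omega\subset\mathbb{C}$ by $X(z)=X(z_0)+\Re\int_{z_0}^z\phi(w)\,dw$, where the isotropic curve $\phi=2\,\partial X/\partial z:\Omega\to\mathbb{C}^3$ is holomorphic, $\phi_1^2+\phi_2^2+\epsilon\phi_3^2=0$ and $|\phi_1|^2+|\phi_2|^2+\epsilon|\phi_3|^2\not\equiv 0$ (the induced metric may degenerate at some points). Its Weierstrass representation is $(g,\omega)$ with $g=\phi_3/(\phi_1-i\phi_2)$, $\omega=(\phi_1-i\phi_2)dz$, so that $\phi\,dz=\left(\tfrac12(1-\epsilon g^2)\omega,\tfrac i2(1+\epsilon g^2)\omega,g\omega\right)$. Dual surface: if $M$ is minimal in $\mathbf{E}^3$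 with isotropic curve $\phi$, then $M^\flat$ is the maximal surface of $\mathbf{L}^3$ with isotropic curve $(-i\phi_1,-i\phi_2,\phi_3)$, defined up to translations. Surfaces of $\mathbf{L}^3$ are identified when, up to reparametrization (holomorphic or antiholomorphic) and a dilation of the ambient space, an orientation-preserving isometry of $\mathbf{L}^3$ (linear part in $SO(2,1)$) takes one onto the other. The Euclidean catenoid with axis $(0,0,1)$ is parametrized on $\mathbb{C}$ (universal cover) by $g=e^z$, $\omega=e^{-z}dz$, up to dilation. The rotations are $$G_t=\begin{pmatrix}\cos t&0&\sin t\\0&1&0\\-\sin t&0&\cos t\end{pmatrix}.$$ The family of Bonnet maximal surfaces in $\mathbf{L}^3$ consists of the maximal surfaces with Weierstrass representation on $\mathbb{C}$ $$g(z)=\frac{\cos\frac s2\,e^z-\sin\frac s2}{\sin\frac s2\,e^z+\cos\frac s2},\qquad \omega=\frac{\left(\sin\frac s2\,e^z+\cos\frac s2\right)^2}{e^z}\,dz,\qquad s\in[0,\pi/2].$$ The elliptic catenoid (rotational maximal surface with timelike axis $(0,0,1)$) is the maximal surface with $g=e^z$, $\omega=e^{-z}dz$; the hyperbolic catenoid (rotational maximal surface with spacelike axis $(1,0,0)$) is the maximal surface with $g=i\frac{e^z-1}{e^z+1}$, $\omega=-i\frac{(e^z+1)^2}{2e^z}dz$, both on $\mathbb{C}$. *)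

(* Defs.v *)
From HB Require Import structures.
From mathcomp Require Import all_boot all_order all_algebra.
From mathcomp Require Import all_classical all_reals all_analysis.
From mathcomp Require Import complex ring.

Set Implicit Arguments.
Unset Strict Implicit.
Unset Printing Implicit Defensive.

Import Order.TTheory GRing.Theory Num.Theory.
Import numFieldNormedType.Exports.

Local Open Scope classical_set_scope.
Local Open Scope ring_scope.
Local Open Scope complex_scope.

(* 'i%C is 0 +i* 1, while the bare notation is the 'i of numClosedFieldType.
   R[i] carries its topology through the alias R[i]^o; [derivable] over R[i]^o
   is complex differentiability, the increments ranging over R[i]. *)

Definition holomorphic (R : realType) (D : set R[i]^o)
    (f : R[i]^o -> R[i]^o) : Prop :=
  forall z : R[i]^o, D z -> derivable f z 1.

Definition path_in (R : realType) (D : set R[i]^o) (p : R -> R[i]^o) : Prop :=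
  {within `[0, 1], continuous p} /\ forall x : R, 0 <= x <= 1 -> D (p x).

(* [h (s, -)] is, for s from 0 to 1, a deformation of the loop p to the
   constant loop, with fixed base point. *)
Definition null_homotopy (R : realType) (D : set R[i]^o) (p : R -> R[i]^o)
    (h : R * R -> R[i]^o) : Prop :=
  [/\ {within `[0, 1] `*` `[0, 1], continuous h},
      forall s x : R, 0 <= s <= 1 -> 0 <= x <= 1 -> D (h (s, x)),
      forall x : R, 0 <= x <= 1 -> h (0, x) = p x /\ h (1, x) = p 0
    & forall s : R, 0 <= s <= 1 -> h (s, 0) = p 0 /\ h (s, 1) = p 0].

Definition simply_connected (R : realType) (D : set R[i]^o) : Prop :=
  (forall a b, D a -> D b ->
     exists p : R -> R[i]^o, [/\ path_in D p, p 0 = a & p 1 = b]) /\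
  (forall p : R -> R[i]^o, path_in D p -> p 0 = p 1 ->
     exists h, null_homotopy D p h).

Definition simply_connected_domain (R : realType) (D : set R[i]^o) : Prop :=
  [/\ open D, D !=set0 & simply_connected D].

Definition vec3 (T : nmodType) (a b c : T) : 'cV[T]_3 :=
  \col_k [:: a; b; c]`_k.

(* dx^2 + dy^2 + eps dz^2: eps = 1 for E^3, eps = -1 for L^3. *)
Definition metric (R : realType) (eps : R) : 'M[R]_3 :=
  diag_mx (vec3 1 1 eps)^T.

(* phi = 2 dX/dz = dX/dx - i dX/dy. *)
Definition isotropic_curve (R : realType) (D : set R[i]^o)
    (X : R[i] -> 'cV[R]_3) (phi : R[i] -> 'cV[R[i]]_3) : Prop :=
  forall (z : R[i]) (k : 'I_3), D z ->
    is_derive (complex.Re z) 1 (fun x : R => X (x +i* complex.Im z) k 0)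
      (complex.Re (phi z k 0)) /\
    is_derive (complex.Im z) 1 (fun y : R => X (complex.Re z +i* y) k 0)
      (- complex.Im (phi z k 0)).

(* X parametrizes on D a conformal surface of R^3 with the metric of parameter
   eps and phi is its isotropic curve; the induced metric may degenerate at some
   points. *)
Definition conformal_surface (R : realType) (eps : R) (D : set R[i]^o)
    (X : R[i] -> 'cV[R]_3) (phi : R[i] -> 'cV[R[i]]_3) : Prop :=
  [/\ simply_connected_domain D,
      isotropic_curve D X phi,
      forall k : 'I_3, holomorphic D (fun z => phi z k 0),
      forall z, D z ->
        phi z 0 0 ^+ 2 + phi z 1 0 ^+ 2 + eps%:C * phi z 2 0 ^+ 2 = 0
    & exists2 z, D z &
        `|phi z 0 0| ^+ 2 + `|phi z 1 0| ^+ 2 + eps%:C * `|phi z 2 0| ^+ 2 != 0].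

Definition minimal_surface (R : realType) := @conformal_surface R 1.
Definition maximal_surface (R : realType) := @conformal_surface R (- 1).

(* (g, w dz) is the Weierstrass representation of phi. The function g is
   meromorphic, with poles only at zeros of w = phi_1 - i phi_2, where its value
   as a total function is irrelevant. *)
Definition weierstrass (R : realType) (D : set R[i]^o)
    (phi : R[i] -> 'cV[R[i]]_3) (g w : R[i] -> R[i]) : Prop :=
  [/\ exists2 z, D z & w z != 0,
      forall z, D z -> w z = phi z 0 0 - 'i%C * phi z 1 0
    & forall z, D z -> w z != 0 ->
        g z = phi z 2 0 / (phi z 0 0 - 'i%C * phi z 1 0)].

Definition minimal_of_weierstrass (R : realType) (D : set R[i]^o)
    (g w : R[i] -> R[i]) (X : R[i] -> 'cV[R]_3) : Prop :=
  exists2 phi, minimal_surface D X phi & weierstrass D phi g w.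

Definition maximal_of_weierstrass (R : realType) (D : set R[i]^o)
    (g w : R[i] -> R[i]) (X : R[i] -> 'cV[R]_3) : Prop :=
  exists2 phi, maximal_surface D X phi & weierstrass D phi g w.

Lemma weierstrassE (R : realType) (eps : R) D X phi g w :
  @conformal_surface R eps D X phi -> weierstrass D phi g w ->
  forall z, D z -> w z != 0 ->
  phi z = vec3 (2^-1 * (1 - eps%:C * g z ^+ 2) * w z)
               ('i%C / 2 * (1 + eps%:C * g z ^+ 2) * w z)
               (g z * w z).
Proof.
move=> [_ _ _ iso _] [_ wE gE] z Dz wz.
move: (iso z Dz) (wE z Dz) (gE z Dz wz); set e := eps%:C.
set a := phi z 0 0; set b := phi z 1 0; set c := phi z 2 0.
move=> {}iso wab; rewrite -wab => {}gE.
have ii : 'i%C * 'i%C = -1 :> R[i] by rewrite -expr2 sqr_i.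
have cE : c = g z * w z by rewrite gE divfK.
have q : a + 'i%C * b = - e * g z ^+ 2 * w z.
  apply: (mulIf wz); rewrite {1}wab.
  transitivity ((a ^+ 2 + b ^+ 2 + e * c ^+ 2) - e * c ^+ 2
                - ('i%C * 'i%C + 1) * b ^+ 2); first by ring.
  by rewrite iso ii cE; ring.
have two : (2 : R[i]) != 0 by rewrite pnatr_eq0.
have aE : a = 2^-1 * (1 - e * g z ^+ 2) * w z.
  apply: (mulfI two); rewrite !mulrA divff // mul1r.
  transitivity ((a - 'i%C * b) + (a + 'i%C * b)); first by ring.
  by rewrite q -wab; ring.
have bE : b = 'i%C / 2 * (1 + e * g z ^+ 2) * w z.
  apply: (mulfI two).
  transitivity ('i%C * ((a - 'i%C * b) - (a + 'i%C * b))
                + 2 * ('i%C * 'i%C + 1) * b).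
    by ring.
  by rewrite q ii -wab; field.
apply/colP => -[[|[|[|//]]] hk]; rewrite !mxE /= -?aE -?bE -?cE;
  by congr (phi z _ 0); apply/val_inj.
Qed.

Definition dual_curve (R : realType) (phi : R[i] -> 'cV[R[i]]_3)
    (z : R[i]) : 'cV[R[i]]_3 :=
  vec3 (- 'i%C * phi z 0 0) (- 'i%C * phi z 1 0) (phi z 2 0).

Definition dual_surface (R : realType) (D : set R[i]^o)
    (X Y : R[i] -> 'cV[R]_3) : Prop :=
  exists2 phi, minimal_surface D X phi & maximal_surface D Y (dual_curve phi).

Definition SO21 (R : realType) (A : 'M[R]_3) : Prop :=
  A^T *m metric (- 1) *m A = metric (- 1) /\ \det A = 1.

(* A holomorphic bijection has a holomorphic inverse, so h below is a
   reparametrization in the usual sense. *)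
Definition congruent (R : realType) (D : set R[i]^o) (X : R[i] -> 'cV[R]_3)
    (D' : set R[i]^o) (Y : R[i] -> 'cV[R]_3) : Prop :=
  exists (h : R[i]^o -> R[i]^o) (r : R) (A : 'M[R]_3) (b : 'cV[R]_3),
    [/\ set_bij D D' h,
        holomorphic D h \/ holomorphic D (fun z => (h z)^*),
        0 < r,
        SO21 A
      & forall z, D z -> Y (h z) = r *: (A *m X z) + b].

Definition expC (R : realType) (z : R[i]) : R[i] :=
  (expR (complex.Re z))%:C * (cos (complex.Im z) +i* sin (complex.Im z)).

(* The factor r accounts for the catenoid being given up to dilation. *)
Definition euclidean_catenoid (R : realType) (X : R[i] -> 'cV[R]_3) : Prop :=
  exists2 r : R, 0 < r &
    minimal_of_weierstrass setT (@expC R) (fun z => r%:C * expC (- z)) X.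

Definition rotation (R : realType) (t : R) : 'M[R]_3 :=
  \matrix_(i < 3, j < 3)
    (nth [::] [:: [:: cos t;   0; sin t];
                  [:: 0;       1; 0];
                  [:: - sin t; 0; cos t]] i)`_j.

Lemma rotationE (R : realType) (t a b c : R) :
  rotation t *m vec3 a b c =
  vec3 (cos t * a + sin t * c) b (- sin t * a + cos t * c).
Proof.
apply/colP => -[[|[|[|//]]] hk];
  by rewrite !mxE !big_ord_recl big_ord0 !mxE /=; ring.
Qed.

(* The angle between the axis of the rotated catenoid and the z-axis. *)
Lemma rotation_axis_angle (R : realType) (t : R) : 0 <= t <= pi ->
  acos (((rotation t *m vec3 0 0 1)^T *m vec3 0 0 1) 0 0) = t.
Proof.
move=> t0pi; rewrite rotationE !mxE !big_ord_recl big_ord0 !mxE /=.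
by rewrite !mulr0 !mulr1 !add0r addr0 cosK // in_itv.
Qed.

Definition bonnet_surface (R : realType) (s : R) : (R[i] -> 'cV[R]_3) -> Prop :=
  let c : R[i] := (cos (s / 2))%:C in
  let d : R[i] := (sin (s / 2))%:C in
  maximal_of_weierstrass setT
    (fun z => (c * expC z - d) / (d * expC z + c))
    (fun z => (d * expC z + c) ^+ 2 / expC z).

Definition elliptic_catenoid (R : realType) : (R[i] -> 'cV[R]_3) -> Prop :=
  maximal_of_weierstrass setT (@expC R) (fun z => expC (- z)).

Definition hyperbolic_catenoid (R : realType) : (R[i] -> 'cV[R]_3) -> Prop :=
  maximal_of_weierstrass setT
    (fun z : R[i] => 'i%C * ((expC z - 1) / (expC z + 1)))
    (fun z : R[i] => - 'i%C * ((expC z + 1) ^+ 2 / (2 * expC z))).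

(* Main.v *)
Require Import Defs.
From mathcomp Require Import all_boot all_order all_algebra.
From mathcomp Require Import all_classical all_reals all_analysis.
From mathcomp Require Import complex ring lra.

Set Implicit Arguments.
Unset Strict Implicit.
Unset Printing Implicit Defensive.

Import Order.TTheory GRing.Theory Num.Theory.
Import numFieldNormedType.Exports.

Local Open Scope classical_set_scope.
Local Open Scope ring_scope.
Local Open Scope complex_scope.

(* The catenoid has isotropic curve r (- sinh z, i cosh z, 1), so rotating it by
   G_t and dualizing gives
     r (i (cos t sinh z - sin t), cosh z, sin t sinh z + cos t).
   The quarter turn (x, y, z) |-> (y, - x, z) of L^3 takes this to r times the
   isotropic curve of the Bonnet surface of parameter s = t, with no change of
   the parameter z. For t = 0 the latter is the elliptic catenoid, and for
   t = pi / 2 the dual curve itself is r times that of the hyperbolic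
   catenoid. *)

Local Notation toC := (map_mx (real_complex _)).

Lemma mulCii (R : realType) : 'i%C * 'i%C = -1 :> R[i].
Proof. by rewrite -expr2 sqr_i. Qed.

(** Packed as a pair so that one rewrite normalizes both index forms left by [big_ord_recl]. *)
Lemma lift_ord3 :
  (lift ord0 ord0 = 1 :> 'I_3) * (lift ord0 (lift ord0 ord0) = 2 :> 'I_3).
Proof. by split; apply/val_inj. Qed.

(** * Isotropic curves under real linear maps *)

Lemma isotropic_curve_linear (R : realType) (D : set R[i]^o)
    (X : R[i] -> 'cV[R]_3) (phi : R[i] -> 'cV[R[i]]_3) (A : 'M[R]_3) :
  isotropic_curve D X phi ->
  isotropic_curve D (fun z => A *m X z)
    (fun z => toC A *m phi z).
Proof.
move=> Xphi z k Dz; split.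
- rewrite (_ : (fun x => _) =
      \sum_j (fun x : R => A k j *: X (x +i* complex.Im z) j 0)); last first.
    by apply/funext => x; rewrite mxE fct_sumE.
  (* Taking real parts is additive and commutes with the real entries of [A]. *)
  have -> : complex.Re ((toC A *m phi z) k 0) =
            \sum_j A k j *: complex.Re (phi z j 0).
    rewrite mxE raddf_sum; apply: eq_bigr => j _.
    by rewrite mxE; case: (phi z j 0) => a b /=; rewrite mul0r subr0.
  by apply: is_derive_sum => j; apply: is_deriveZ; case: (Xphi z j Dz).
- rewrite (_ : (fun x => _) =
      \sum_j (fun y : R => A k j *: X (complex.Re z +i* y) j 0)); last first.
    by apply/funext => x; rewrite mxE fct_sumE.
  have -> : - complex.Im ((toC A *m phi z) k 0) =
            \sum_j A k j *: - complex.Im (phi z j 0).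
    rewrite mxE raddf_sum -sumrN; apply: eq_bigr => j _.
    rewrite mxE; case: (phi z j 0) => a b /=.
    by rewrite mul0r addr0 scalerN.
  by apply: is_derive_sum => j; apply: is_deriveZ; case: (Xphi z j Dz).
Qed.

(** The partial derivatives of [X] are the real part and minus the imaginary part of the curve. This
    identifies the otherwise unspecified curve hidden in [dual_surface]. *)
Lemma isotropic_curve_unique (R : realType) (D : set R[i]^o)
    (X : R[i] -> 'cV[R]_3) (phi psi : R[i] -> 'cV[R[i]]_3) :
  isotropic_curve D X phi -> isotropic_curve D X psi ->
  forall z, D z -> phi z = psi z.
Proof.
move=> Xphi Xpsi z Dz; apply/colP => k.
have [phiRe phiIm] := Xphi z k Dz; have [psiRe psiIm] := Xpsi z k Dz.
apply/eqP; rewrite eq_complex; apply/andP; split; apply/eqP.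
  by rewrite -(@derive_val _ _ _ _ _ _ _ phiRe) -(@derive_val _ _ _ _ _ _ _ psiRe).
apply: oppr_inj.
by rewrite -(@derive_val _ _ _ _ _ _ _ phiIm) -(@derive_val _ _ _ _ _ _ _ psiIm).
Qed.

(** This form is bilinear, not Hermitian: [v = u] gives the isotropy condition, and [v] conjugate to
    [u] gives the induced metric. *)
Lemma metric_form (R : realType) (eps : R) (u v : 'cV[R[i]]_3) :
  (u^T *m toC (metric eps) *m v) 0 0 =
  u 0 0 * v 0 0 + u 1 0 * v 1 0 + eps%:C * (u 2 0 * v 2 0).
Proof.
rewrite !mxE !big_ord_recl big_ord0 !mxE !big_ord_recl !big_ord0 !mxE /=.
rewrite !lift_ord3 !(rmorph0, rmorph1).
by ring.
Qed.

Lemma metric_form_similarity (R : realType) (eps k : R) (A : 'M[R]_3)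
    (u v : 'cV[R[i]]_3) :
  A^T *m metric eps *m A = k *: metric eps ->
  ((toC A *m u)^T *m toC (metric eps) *m (toC A *m v)) 0 0 =
  k%:C * (u^T *m toC (metric eps) *m v) 0 0.
Proof.
move=> Aq; set Ac := toC A; set q := toC _.
have -> : (Ac *m u)^T *m q *m (Ac *m v) = u^T *m (Ac^T *m q *m Ac) *m v.
  by rewrite trmx_mul !mulmxA.
have -> : Ac^T *m q *m Ac = k%:C *: q.
  by rewrite /Ac /q map_trmx -!map_mxM Aq map_mxZ.
by rewrite -scalemxAr -scalemxAl mxE.
Qed.

(** Isotropy and non-degeneracy both concern values of the bilinear form, which [A] multiplies by
    the nonzero factor [k]. *)
Lemma conformal_surface_similarity (R : realType) (eps k : R) (D : set R[i]^o)
    (X : R[i] -> 'cV[R]_3) (phi : R[i] -> 'cV[R[i]]_3) (A : 'M[R]_3) :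
  A^T *m metric eps *m A = k *: metric eps -> k != 0 ->
  conformal_surface eps D X phi ->
  conformal_surface eps D (fun z => A *m X z)
    (fun z => toC A *m phi z).
Proof.
move=> Aq k0 [scD Xphi phih phi0 [z0 Dz0 phiN0]].
split; first exact: scD.
- exact: isotropic_curve_linear Xphi.
- move=> k' z Dz.
  rewrite (_ : (fun z => _) =
      \sum_j (fun z : R[i]^o => (A k' j)%:C *: (phi z j 0 : R[i]^o))).
    by apply: derivable_sum => j; apply: derivableZ; exact: phih.
  by apply/funext => w; rewrite mxE fct_sumE; apply: eq_bigr => j _; rewrite mxE.
- move=> z Dz; have := metric_form_similarity (phi z) (phi z) Aq.
  by rewrite !metric_form -!expr2 phi0 // mulr0.
- exists z0 => //.
  have conjA : map_mx (@conjc R) (toC A) = toC A.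
    by rewrite -map_mx_comp; apply: eq_map_mx => x; exact: conjc_real.
  (* |phi|^2 is the form at (phi, conj phi), and conj commutes with the real A. *)
  have := metric_form_similarity (phi z0) (map_mx (@conjc R) (phi z0)) Aq.
  rewrite -{2}conjA -map_mxM !metric_form !mxE -!sqr_normc => E.
  by rewrite E mulf_neq0 // fmorph_eq0.
Qed.

(** * Complex exponential and hyperbolic functions *)

Lemma expC_mulN (R : realType) (z : R[i]) : expC z * expC (- z) = 1.
Proof.
case: z => a b; rewrite /expC /= cosN sinN; apply/eqP.
rewrite eq_complex /=; apply/andP; split; apply/eqP.
  rewrite !mul0r !subr0 !addr0.
  transitivity ((expR a * expR (- a)) * (cos b ^+ 2 + sin b ^+ 2)); first by ring.
  by rewrite cos2Dsin2 mulr1 expRxMexpNx_1.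
by rewrite !mul0r !subr0 !addr0; ring.
Qed.

Lemma expC_neq0 (R : realType) (z : R[i]) : expC z != 0.
Proof.
by apply/eqP => z0; have := expC_mulN z; rewrite z0 mul0r => /eqP; rewrite eq_sym oner_eq0.
Qed.

Lemma expCN (R : realType) (z : R[i]) : expC (- z) = (expC z)^-1.
Proof. by apply: (mulfI (expC_neq0 z)); rewrite expC_mulN divff ?expC_neq0. Qed.

Definition sinhC (R : realType) (z : R[i]) : R[i] := 2^-1 * (expC z - expC (- z)).
Definition coshC (R : realType) (z : R[i]) : R[i] := 2^-1 * (expC z + expC (- z)).

Lemma expC0 (R : realType) : expC (0 : R[i]) = 1.
Proof. by rewrite /expC /= expR0 cos0 sin0 mul1r. Qed.

(** * Curves of the catenoid and of its rotated duals *)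

Lemma catenoid_curve (R : realType) (C : R[i] -> 'cV[R]_3) :
  euclidean_catenoid C ->
  exists2 r : R, 0 < r & exists2 phi, minimal_surface setT C phi &
    forall z, phi z = r%:C *: vec3 (- sinhC z) ('i%C * coshC z) 1.
Proof.
move=> [r r0 [phi Cphi Wphi]]; exists r => //; exists phi => // z.
(* The form has no zeros, so the Weierstrass formula holds at every [z]. *)
have rz0 : r%:C * expC (- z) != 0.
  by rewrite mulf_neq0 ?expC_neq0 // fmorph_eq0 gt_eqF.
rewrite (weierstrassE Cphi Wphi I rz0) rmorph1 /sinhC /coshC expCN.
have E0 := expC_neq0 z.
by apply/colP => -[[|[|[|//]]] hk]; rewrite !mxE /=; field.
Qed.

Lemma dual_rotated_catenoid_curve (R : realType) (C : R[i] -> 'cV[R]_3) (t : R)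
    (M : R[i] -> 'cV[R]_3) :
  euclidean_catenoid C -> dual_surface setT (fun z => rotation t *m C z) M ->
  exists2 r : R, 0 < r & exists2 psi, maximal_surface setT M psi &
    forall z, psi z = r%:C *:
      vec3 ('i%C * ((cos t)%:C * sinhC z - (sin t)%:C)) (coshC z)
           ((sin t)%:C * sinhC z + (cos t)%:C).
Proof.
move=> /catenoid_curve[r r0 [phi [_ Cphi _ _ _] phiE]] [rphi [_ rCphi _ _ _] Mpsi].
exists r => //; exists (dual_curve rphi) => // z.
have -> : dual_curve rphi z = dual_curve (fun w => toC (rotation t) *m phi w) z.
  by rewrite /dual_curve (isotropic_curve_unique rCphi (isotropic_curve_linear _ Cphi)).
rewrite /dual_curve !mxE !big_ord_recl !big_ord0 !lift_ord3 phiE !mxE /=.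
rewrite !(rmorph0, rmorph1, rmorphN).
apply/colP => -[[|[|[|//]]] hk]; rewrite !mxE /=; first by ring.
  (* The square of ['i%C] is isolated because [ring] does not know that it is -1. *)
  transitivity (- ('i%C * 'i%C) * (r%:C * coshC z)); first by ring.
  by rewrite mulCii; ring.
by ring.
Qed.

(** Multiplying by [w] replaces the quotient defining [g] by an identity convenient for [field]. *)
Lemma weierstrass_curve (R : realType) (D : set R[i]^o)
    (phi : R[i] -> 'cV[R[i]]_3) (g w : R[i] -> R[i]) :
  (exists2 z, D z & w z != 0) ->
  (forall z, D z -> w z = phi z 0 0 - 'i%C * phi z 1 0) ->
  (forall z, D z -> w z != 0 -> g z * w z = phi z 2 0) ->
  weierstrass D phi g w.
Proof.
move=> w0 wE gwE; split=> // z Dz wz.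
by rewrite -wE // -gwE // mulfK.
Qed.

(** The image of [M] under [r *: A] serves as [B], with identity reparametrization and no
    translation. Each congruence thus reduces to computing Weierstrass data. *)
Lemma maximal_similar (R : realType) (M : R[i] -> 'cV[R]_3)
    (psi : R[i] -> 'cV[R[i]]_3) (r : R) (A : 'M[R]_3) (g w : R[i] -> R[i]) :
  maximal_surface setT M psi -> 0 < r -> SO21 A ->
  weierstrass setT (fun z => toC (r *: A) *m psi z) g w ->
  exists2 B, maximal_of_weierstrass setT g w B & congruent setT M setT B.
Proof.
move=> Mpsi r0 SOA W; exists (fun z => (r *: A) *m M z).
  exists (fun z => toC (r *: A) *m psi z) => //.
  (* The form is quadratic in the matrix, so the dilation [r] contributes [r ^+ 2]. *)
  apply: (@conformal_surface_similarity _ _ (r ^+ 2)) Mpsi; last first.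
    by rewrite expf_neq0 // gt_eqF.
  rewrite -scalemxAr [(r *: A)^T]linearZ /= -!scalemxAl scalerA SOA.1.
  by rewrite expr2.
exists id, r, A, 0; split=> //.
- by split => // z _; exists z.
- by left => z _; exact: derivable_id.
- by move=> z _; rewrite -scalemxAl addr0.
Qed.

Definition quarter_turn (R : realType) : 'M[R]_3 :=
  \matrix_(i < 3, j < 3)
    (nth [::] [:: [:: 0; 1; 0]; [:: - 1; 0; 0]; [:: 0; 0; 1]] i)`_j.

Lemma SO21_quarter_turn (R : realType) : SO21 (quarter_turn R).
Proof.
split; last first.
  rewrite (expand_det_row _ ord0) !big_ord_recl big_ord0 /cofactor.
  rewrite !(expand_det_row _ (ord0 : 'I_2)) !big_ord_recl !big_ord0 /cofactor.
  by rewrite !det_mx11 !mxE /= /bump /=; ring.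
apply/matrixP => -[[|[|[|//]]] hi] -[[|[|[|//]]] hj];
  rewrite !mxE !big_ord_recl !big_ord0 !mxE !big_ord_recl !big_ord0 !mxE /=; ring.
Qed.

Lemma SO21_1 (R : realType) : SO21 (1%:M : 'M[R]_3).
Proof. by split; rewrite ?det1 // trmx1 mulmx1 mul1mx. Qed.

(** The double-angle formulas turn the curve in [cos t], [sin t] into the Bonnet data in the half
    angle; the dilation by [r^-1] removes the size of the catenoid. *)
Lemma dual_rotated_catenoid_bonnet (R : realType) (C : R[i] -> 'cV[R]_3) (t : R)
    (M : R[i] -> 'cV[R]_3) :
  0 <= t <= pi / 2 ->
  euclidean_catenoid C -> dual_surface setT (fun z => rotation t *m C z) M ->
  exists2 B, bonnet_surface t B & congruent setT M setT B.
Proof.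
move=> /andP[t0 tpi] hC hM.
have [r r0 [psi Mpsi psiE]] := dual_rotated_catenoid_curve hC hM.
have rV0 : 0 < r^-1 by rewrite invr_gt0.
apply: (maximal_similar Mpsi rV0 (SO21_quarter_turn R)).
set c := cos (t / 2); set d := sin (t / 2).
have c0 : 0 < c.
  apply: cos_gt0_pihalf; have := pi_gt0 R; move: t0 tpi; lra.
have d0 : 0 <= d.
  apply: sin_ge0_pi; have := pi_gt0 R; move: t0 tpi; lra.
have costE : (cos t)%:C = c%:C ^+ 2 - d%:C ^+ 2 :> R[i].
  by rewrite -!rmorphXn -rmorphB /=; congr (_%:C); rewrite {1}(splitr t) cosD -!expr2.
have sintE : (sin t)%:C = 2 * (c%:C * d%:C) :> R[i].
  rewrite -rmorphM -(rmorph_nat (real_complex R)) -rmorphM /=; congr (_%:C).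
  by rewrite {1}(splitr t) sinD -/c -/d; ring.
have cd1 : c%:C ^+ 2 + d%:C ^+ 2 = 1 :> R[i].
  by rewrite -!rmorphXn -rmorphD cos2Dsin2.
have rC0 : r%:C != 0 :> R[i] by rewrite fmorph_eq0 gt_eqF.
have phiE z : toC (r^-1 *: quarter_turn R) *m psi z =
  vec3 (coshC z) ('i%C * ((sin t)%:C - (cos t)%:C * sinhC z))
       ((sin t)%:C * sinhC z + (cos t)%:C).
  rewrite psiE; apply/colP => -[[|[|[|//]]] hk];
  rewrite !mxE !big_ord_recl big_ord0 !mxE /= !rmorphM !fmorphV /=;
  rewrite !(rmorph0, rmorph1, rmorphN); by field.
apply: weierstrass_curve.
(* At 0 the form equals [(d + c) ^+ 2], nonzero since [c > 0] and [d >= 0]. *)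
- exists 0 => //; rewrite expC0 divr1 mulr1 expf_neq0 // -rmorphD fmorph_eq0.
  by rewrite gt_eqF // ltr_wpDl.
- move=> z _; rewrite phiE !mxE /= mulrA mulCii sintE costE /coshC /sinhC expCN.
  have E0 := expC_neq0 z.
  (* The added term vanishes by [cd1]; with it the equality becomes a rational identity in
     independent [c] and [d]. *)
  transitivity (((1 - (c%:C ^+ 2 + d%:C ^+ 2)) / 2 * (expC z + (expC z)^-1)) +
    (d%:C * expC z + c%:C) ^+ 2 / expC z); first by rewrite cd1 subrr !mul0r add0r.
  by field.
- move=> z _ wz; rewrite phiE !mxE /= sintE costE /sinhC expCN.
  have E0 := expC_neq0 z.
  (* A pole of [g] would be a zero of [w], which [wz] excludes. *)
  have f0 : d%:C * expC z + c%:C != 0.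
    by apply: contraNneq wz => ->; rewrite expr0n mul0r.
  by field; rewrite E0 f0.
Qed.

(** The half angle has cosine 1 and sine 0, so the Weierstrass data agree as functions, without any
    congruence. *)
Lemma bonnet0 (R : realType) : @bonnet_surface R 0 = @elliptic_catenoid R.
Proof.
rewrite /bonnet_surface /elliptic_catenoid mul0r cos0 sin0.
by congr maximal_of_weierstrass; apply/funext => z;
  rewrite ?expCN /= !(rmorph0, rmorph1) mul0r add0r ?mul1r ?subr0 ?divr1 ?expr1n ?mul1r.
Qed.

(** The dual already has axis (1,0,0), so the identity replaces the quarter turn and only the
    dilation by [r^-1] remains. *)
Lemma dual_rotated_catenoid_hyperbolic (R : realType) (C : R[i] -> 'cV[R]_3)
    (M : R[i] -> 'cV[R]_3) :
  euclidean_catenoid C ->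
  dual_surface setT (fun z => rotation (pi / 2) *m C z) M ->
  exists2 H, hyperbolic_catenoid H & congruent setT M setT H.
Proof.
move=> hC hM.
have [r r0 [psi Mpsi psiE]] := dual_rotated_catenoid_curve hC hM.
have rV0 : 0 < r^-1 by rewrite invr_gt0.
apply: (maximal_similar Mpsi rV0 (SO21_1 R)).
have rC0 : r%:C != 0 :> R[i] by rewrite fmorph_eq0 gt_eqF.
have i0 : 'i%C != 0 :> R[i] by rewrite eq_complex /= oner_eq0 andbF.
have phiE z : toC (r^-1 *: 1%:M) *m psi z = vec3 (- 'i%C) (coshC z) (sinhC z).
  rewrite psiE cos_pihalf sin_pihalf map_mxZ map_mx1 -scalemxAl mul1mx scalerA.
  rewrite fmorphV mulVf // scale1r.
  by apply/colP => -[[|[|[|//]]] hk]; rewrite !mxE /= ?(rmorph0, rmorph1); ring.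
apply: weierstrass_curve.
(* At 0 the form takes the value -2i. *)
- by exists 0 => //; rewrite expC0 mulr1 -mulr2n mulf_neq0 ?oppr_eq0.
- move=> z _; rewrite phiE !mxE /= /coshC expCN.
  have E0 := expC_neq0 z.
  by field.
- move=> z _ wz; rewrite phiE !mxE /= /sinhC expCN.
  have E0 := expC_neq0 z.
  have f0 : expC z + 1 != 0.
    by apply: contraNneq wz => ->; rewrite expr0n mul0r mulr0.
  transitivity (- ('i%C * 'i%C) * ((expC z - 1) * (expC z + 1) / (2 * expC z))).
    by field; rewrite E0 f0.
  by rewrite mulCii; field.
Qed.

Theorem theorem4p2 (R : realType) (C : R[i] -> 'cV[R]_3)
    (hC : euclidean_catenoid C)
    (t : R) (ht : 0 <= t <= pi / 2) (M : R[i] -> 'cV[R]_3)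
    (hM : dual_surface setT (fun z => rotation t *m C z) M) :
  [/\ exists2 s : R, 0 <= s <= pi / 2 &
        exists2 B, bonnet_surface s B & congruent setT M setT B,
      t = 0 -> exists2 E, elliptic_catenoid E & congruent setT M setT E
    & t = pi / 2 ->
        exists2 H, hyperbolic_catenoid H & congruent setT M setT H].
Proof.
split.
- by exists t => //; exact: dual_rotated_catenoid_bonnet hC hM.
- move=> t0; rewrite -bonnet0 -t0; exact: dual_rotated_catenoid_bonnet hC hM.
- move=> tpi; rewrite tpi in hM; exact: dual_rotated_catenoid_hyperbolic hC hM.
Qed.
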